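(* Let $\Theta\subset\mathbb{R}^p$ and $\Lambda\subset\mathbb{R}^q$ be open and let $F:\Theta\times\Lambda\to\mathbb{R}^{K+1}$ be the joint weak feature map $$F(\theta,\lambda)=\bigl(\langle T_\theta,x^{j_0}\varphi_\lambda(x)\rangle,\ldots,\langle T_\theta,x^{j_K}\varphi_\lambda(x)\rangle\bigr).$$ If, for every $(\theta,\lambda)\in\Theta\times\Lambda$, the Jacobian $DF(\theta,\lambda)$ is surjective (i.e. has rank $K+1$), then $F$ is transversal to $D$ for every smooth submanifold $D\subset\mathbb{R}^{K+1}$.
   Context: Here $\{T_\theta:\theta\in\Theta\}\subset\mathcal{S}'(\mathbb{R})$ is a family of tempered distributions, $\{\varphi_\lambda\}_{\lambda\in\Lambda}\subset\mathcal{S}(\mathbb{R})$ is a family of positive Schwartz functions (kernels), $0\le j_0<\cdots<j_K$ are fixed integers, and the joint map $F$ is of class $C^r$ with $r\ge1$. A map $f:M\to N$ between manifolds (of class $C^1$ at least) is transversal to a submanifold $S\subset N$ if for every $x\in f^{-1}(S)$ one has $Df_x(T_xM)+T_{f(x)}S=T_{f(x)}N$. *)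

(* Defs.v *)
From HB Require Import structures.
From mathcomp Require Import all_boot all_order all_algebra.
From mathcomp Require Import all_classical all_reals all_analysis.

Set Implicit Arguments.
Unset Strict Implicit.
Unset Printing Implicit Defensive.

Import Order.TTheory GRing.Theory Num.Theory.
Import numFieldNormedType.Exports.

Local Open Scope classical_set_scope.
Local Open Scope ring_scope.

(** * Schwartz functions and tempered distributions on the real line

    Everything is real-valued: the feature map takes its values in R^(K+1). *)

Section Schwartz.
Context {R : realType}.

Definition schwartz_fun (f : R -> R^o) : Prop :=
  (forall n x, derivable (derive1n n f) x 1) /\
  (forall a b : nat, exists M : R, forall x, `|x ^+ a * derive1n b f x| <= M).

Definition schwartz_pred : {pred R -> R^o} := fun f => `[< schwartz_fun f >].

Lemma schwartz_predP f : reflect (schwartz_fun f) (f \in schwartz_pred).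
Proof. exact: asboolP. Qed.

Let derivable_all (f : R -> R^o) := forall n x, derivable (derive1n n f) x 1.

Lemma derive1n_lin (c : R) (f g : R -> R^o) n :
  derivable_all f -> derivable_all g ->
  derive1n n (c *: f + g) = c *: derive1n n f + derive1n n g.
Proof.
move=> df dg; elim: n => [//|n IH]; apply/funext => x.
rewrite !derive1nS IH derive1E.
rewrite deriveD; [|exact/derivableZ/df|exact: dg].
by rewrite deriveZ -?derive1E//; exact: df.
Qed.

Lemma schwartz_submod : submod_closed schwartz_pred.
Proof.
have d0 n : derive1n n (0 : R -> R^o) = 0.
  elim: n => [//|n IH]; rewrite derive1nS IH.
  by apply/funext => x; rewrite derive1E derive_cst.
split.
  apply/schwartz_predP; split=> [n x|a b].
    by rewrite d0; exact: derivable_cst.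
  by exists 0 => x; rewrite d0 /= mulr0 normr0.
move=> c f g /schwartz_predP[df bf] /schwartz_predP[dg bg].
apply/schwartz_predP; split=> [n x|a b].
  by rewrite derive1n_lin//; apply: derivableD; [exact/derivableZ/df|exact: dg].
have [M hM] := bf a b; have [N hN] := bg a b.
exists (`|c| * M + N) => x; rewrite derive1n_lin//.
rewrite -[(_ + _) x]/(c * derive1n b f x + derive1n b g x) mulrDr mulrCA.
rewrite (le_trans (ler_normD _ _))// lerD//.
by rewrite normrM ler_wpM2l.
Qed.

HB.instance Definition _ :=
  GRing.isSubmodClosed.Build R (R -> R^o) schwartz_pred schwartz_submod.

Record schwartz := Schwartz { schwartz_val :> R -> R^o;
                              _ : schwartz_val \in schwartz_pred }.

HB.instance Definition _ := [isSub for schwartz_val].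
HB.instance Definition _ := [Choice of schwartz by <:].
HB.instance Definition _ := [SubChoice_isSubLmodule of schwartz by <:].

Lemma schwartzP (f : schwartz) : schwartz_fun f.
Proof. exact/schwartz_predP/(valP f). Qed.

(** The usual Frechet topology: [f] is sent to the family of all the functions
    [x ^ a * f^(b) x], each of them in the topology of uniform convergence, so
    that the initial topology is the one of the seminorms
    [sup_x |x ^ a * f^(b) x|]. *)
Definition schwartz_embed (f : schwartz) :
    {ptws (nat * nat)%type -> {uniform R -> R}} :=
  fun ab x => x ^+ ab.1 * derive1n ab.2 (f : R -> R^o) x.

HB.instance Definition _ :=
  Topological.copy schwartz (initial_topology schwartz_embed).

Record tempered_distribution := TemperedDistribution {
  pairing :> {linear schwartz -> R^o};
  pairing_continuous : continuous pairing }.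

Lemma derive1n_mulX (f : R -> R^o) n x : derivable_all f ->
  derive1n n ((fun y => y * f y) : R -> R^o) x
    = x * derive1n n f x + n%:R * derive1n n.-1 f x.
Proof.
move=> df; elim: n x => [|n IH] x; first by rewrite mul0r addr0.
rewrite derive1nS (_ : derive1n n _ =
  (id \* derive1n n f : R -> R^o) + n%:R *: derive1n n.-1 f); last exact/funext.
rewrite derive1E deriveD; last 2 first.
- by apply: derivableM; [exact: derivable_id|exact: df].
- exact/derivableZ/df.
rewrite deriveM; [|exact: derivable_id|exact: df].
rewrite deriveZ; last exact: df.
rewrite derive_id -!derive1E -!derive1nS.
rewrite /GRing.scale /= mulr1 -addrA; congr (_ + _).
case: n {IH} => [|n]; first by rewrite mul0r addr0 mul1r.
by rewrite -[in RHS]natr1 mulrDl mul1r addrC.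
Qed.

Lemma schwartz_mulX (f : R -> R^o) :
  schwartz_fun f -> schwartz_fun (fun x => x * f x).
Proof.
move=> [df bf]; split=> [n x|a b].
  rewrite (_ : derive1n n _ =
    (id \* derive1n n f : R -> R^o) + n%:R *: derive1n n.-1 f).
    apply: derivableD; last exact/derivableZ/df.
    by apply: derivableM; [exact: derivable_id|exact: df].
  by apply/funext => y; rewrite derive1n_mulX.
have [M hM] := bf a.+1 b; have [N hN] := bf a b.-1.
exists (M + b%:R * N) => x; rewrite derive1n_mulX// mulrDr.
rewrite (le_trans (ler_normD _ _))// lerD//; first by rewrite mulrA -exprSr.
by rewrite mulrCA normrM normr_nat ler_wpM2l.
Qed.

Lemma schwartz_mulXn j (f : schwartz) :
  ((fun x => x ^+ j * f x) : R -> R^o) \in schwartz_pred.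
Proof.
apply/schwartz_predP; elim: j => [|j /schwartz_mulX].
  rewrite (_ : (fun _ => _) = f); first exact: schwartzP.
  by apply/funext => x; rewrite expr0 mul1r.
by congr schwartz_fun; apply/funext => x; rewrite exprS mulrA.
Qed.

Definition mulXn j (f : schwartz) : schwartz := Schwartz (schwartz_mulXn j f).

End Schwartz.
Arguments schwartz : clear implicits.
Arguments tempered_distribution : clear implicits.

(** * Calculus on open sets, submanifolds, transversality *)

Section Calculus.
Context {R : realType}.
Implicit Types V W : normedModType R.

(** [U] is meant to be open and [V] finite-dimensional; then continuity of
    [x |-> 'd f x v] for every fixed [v] amounts to continuity of
    [x |-> 'd f x], and so on for the higher differentials. *)
Fixpoint class_C (k : nat) V W (U : set V) (f : V -> W) : Prop :=
  match k with
  | 0 => forall x, U x -> {for x, continuous f}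
  | k'.+1 => (forall x, U x -> differentiable f x) /\
             (forall v, class_C k' U (fun x => 'd f x v))
  end.

Definition smooth V W (U : set V) (f : V -> W) := forall k, class_C k U f.

Definition diffeomorphism V W (U : set V) (U' : set W)
    (f : V -> W) (g : W -> V) : Prop :=
  [/\ open U /\ open U',
      smooth U f /\ smooth U' g,
      f @` U `<=` U' /\ g @` U' `<=` U,
      forall x, U x -> g (f x) = x &
      forall y, U' y -> f (g y) = y].

(** Embedded C^oo submanifolds of R^n of dimension [d]: around each point of
    [D], a diffeomorphism straightens [D] to R^d x {0}. *)
Definition smooth_submanifold (n d : nat) (D : set 'rV[R]_n) : Prop :=
  (d <= n)%N /\
  forall y, D y -> exists (U U' : set 'rV[R]_n) (f g : 'rV[R]_n -> 'rV[R]_n),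
    [/\ U y, diffeomorphism U U' f g &
        forall x, U x -> (D x <-> forall i : 'I_n, (d <= i)%N -> f x 0 i = 0)].

(** Velocities at [y] of the C^1 curves drawn on [S]. *)
Definition tangent_space V (S : set V) (y : V) : set V :=
  [set derive1 gamma 0 | gamma in [set gamma : R -> V | gamma 0 = y /\
     exists I : set R, [/\ open_nbhs 0 I, class_C 1 I gamma &
                           gamma @` I `<=` S]]].

(** [f] is regarded as a map from the open subset [M] of [V] to [W]. *)
Definition transversal_to V W (M : set V) (f : V -> W) (S : set W) : Prop :=
  forall x, M x -> S (f x) ->
    [set 'd f x v + w | v in tangent_space M x & w in tangent_space S (f x)]
    = tangent_space [set: W] (f x).

End Calculus.

Definition weak_feature_map (R : realType) (p q K : nat)
    (T : 'rV[R]_p -> tempered_distribution R) (phi : 'rV[R]_q -> schwartz R)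
    (j : 'I_K.+1 -> nat) (z : 'rV[R]_p * 'rV[R]_q) : 'rV[R]_K.+1 :=
  \row_i T z.1 (mulXn (j i) (phi z.2)).

(* Main.v *)
Require Import Defs.
From mathcomp Require Import all_boot all_order all_algebra.
From mathcomp Require Import all_classical all_reals all_analysis.
Import Order.TTheory GRing.Theory Num.Theory.
Import numFieldNormedType.Exports.
Local Open Scope classical_set_scope.
Local Open Scope ring_scope.

(** A surjective differential already fills the target on its own, so every
    vector [u] of the target is the image of some [v] plus the zero vector.  The
    vector [v] is tangent to the domain because an open set contains a short
    segment through each of its points in every direction, and zero is tangent to
    any set at any of its points, as the velocity of a stationary curve.  Both are
    velocities of affine curves ([affine_velocity]), which gives the
    transversality of any submersion on an open set to any subset of
    the target ([submersion_transversal_to]).  For the feature map, it remains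
    only to see that a product of open sets is open. *)

Section AffineCurves.
Context {R : realType}.
Implicit Types V W : normedModType R.

Let affine_is_diff {V} (x v : V) (t : R) :
  is_diff t (fun s : R => x + s *: v) (fun s : R => s *: v).
Proof.
have Hd : is_diff t (cst x + *:%R^~ v) (0 + *:%R^~ v) by apply: is_diffD.
by rewrite add0r in Hd.
Qed.

(** The differential of an affine curve does not depend on the base point, so
    its continuity is that of a constant. *)
Lemma class_C1_affine {V} (x v : V) (I : set R) :
  class_C 1 I (fun t : R => x + t *: v).
Proof.
split=> [t _|h t _]; first by have [] := affine_is_diff x v t.
rewrite (_ : (fun s => _) = cst (h *: v)); first exact: cst_continuous.
by apply/funext => s; have Hd := affine_is_diff x v s; rewrite diff_val.
Qed.

Lemma derive1_affine {V} (x v : V) (t : R) :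
  derive1 (fun s : R => x + s *: v) t = v.
Proof.
have Hd := affine_is_diff x v t.
by rewrite derive1E'; [rewrite diff_val scale1r|case: Hd].
Qed.

Lemma affine_velocity {V} (S : set V) (x v : V) (I : set R) :
  open_nbhs 0 I -> (forall t, I t -> S (x + t *: v)) -> tangent_space S x v.
Proof.
move=> I0 IS; exists (fun t : R => x + t *: v); last exact: derive1_affine.
split; first by rewrite scale0r addr0.
exists I; split=> //; first exact: class_C1_affine.
by move=> _ [t It <-]; exact: IS.
Qed.

Lemma tangent_space_open {V} (M : set V) (x : V) :
  open M -> M x -> tangent_space M x = [set: V].
Proof.
move=> Mo Mx; apply/seteqP; split=> // v _.
apply: (@affine_velocity _ _ _ _ [set t : R | M (x + t *: v)]) => //.
split; last by rewrite /= scale0r addr0.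
apply: (@open_comp _ _ (fun t : R => x + t *: v)) => // t _.
by apply: differentiable_continuous; case: (affine_is_diff x v t).
Qed.

Lemma tangent_space0 {V} (S : set V) (x : V) : S x -> tangent_space S x 0.
Proof.
move=> Sx; apply: (@affine_velocity _ _ _ _ setT).
  by split=> //; exact: openT.
by move=> t _; rewrite scaler0 addr0.
Qed.

Lemma submersion_transversal_to {V W} (M : set V) (f : V -> W) (S : set W) :
  open M -> (forall x, M x -> range ('d f x) = [set: W]) ->
  transversal_to M f S.
Proof.
move=> Mo f_subm x Mx Sfx.
rewrite (tangent_space_open _ _ openT)// (tangent_space_open _ _ Mo Mx).
apply/seteqP; split=> // u _.
have [v _ dfv] : range ('d f x) u by rewrite f_subm.
exists v => //; exists 0; first exact: tangent_space0.
by rewrite addr0.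
Qed.

End AffineCurves.

Theorem theorem5p3 (R : realType) (p q K r : nat)
  (Theta : set 'rV[R]_p) (Lambda : set 'rV[R]_q)
  (T : 'rV[R]_p -> tempered_distribution R) (phi : 'rV[R]_q -> schwartz R)
  (j : 'I_K.+1 -> nat)
  (Theta_open : open Theta) (Lambda_open : open Lambda)
  (phi_pos : forall l, Lambda l -> forall x : R, 0 < phi l x)
  (j_incr : forall a b : 'I_K.+1, (a < b)%N -> (j a < j b)%N)
  (r_ge1 : (1 <= r)%N)
  (F_Cr : class_C r (Theta `*` Lambda) (weak_feature_map T phi j))
  (DF_surj : forall z, (Theta `*` Lambda) z ->
     range ('d (weak_feature_map T phi j) z) = [set: 'rV[R]_K.+1]) :
  forall (d : nat) (D : set 'rV[R]_K.+1), smooth_submanifold d D ->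
    transversal_to (Theta `*` Lambda) (weak_feature_map T phi j) D.
Proof.
move=> d D _; apply: submersion_transversal_to DF_surj.
rewrite openE => -[a b] [/= Ta Lb].
by exists (Theta, Lambda) => //; split; exact: open_nbhs_nbhs.
Qed.
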